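(* The set $\mathcal{F}$ of all fusible numbers, with the order inherited from $\mathbb{R}$, is well-ordered.
   Context: The fuse operation is the partial binary operation on real numbers $a\sim b=(a+b+1)/2$, applicable only when $|a-b|<1$. A fusible number is a real number obtainable from $0$ by finitely many (valid) applications of the fuse operation; i.e. the set $\mathcal{F}$ of fusible numbers is the smallest subset of $\mathbb{R}$ such that $0\in\mathcal{F}$ and, whenever $a,b\in\mathcal{F}$ and $|a-b|<1$, also $(a+b+1)/2\in\mathcal{F}$. *)

(* Defs.v *)
From mathcomp Require Import all_boot all_order all_algebra.
From mathcomp Require Import boolp classical_sets wochoice reals.

Set Implicit Arguments.
Unset Strict Implicit.
Unset Printing Implicit Defensive.

Import Order.TTheory GRing.Theory Num.Theory.
Local Open Scope ring_scope.

(* Total on all pairs; the applicability condition `|a - b| < 1 of the partial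
   operation is imposed where it is used, in [fusible_fuse]. *)
Definition fuse (R : realType) (a b : R) : R := (a + b + 1) / 2.

Inductive fusible (R : realType) : R -> Prop :=
| fusible0 : fusible 0
| fusible_fuse a b :
    fusible a -> fusible b -> `|a - b| < 1 -> fusible (fuse a b).

Definition fusible_numbers (R : realType) : set R := [set x | fusible x]%classic.
Arguments fusible_numbers : clear implicits.

(* Main.v *)
Require Import Defs.
From mathcomp Require Import all_boot all_order all_algebra.
From mathcomp Require Import boolp classical_sets wochoice reals.
From mathcomp Require Import lra.

Set Implicit Arguments.
Unset Strict Implicit.
Unset Printing Implicit Defensive.

Import Order.TTheory GRing.Theory Num.Theory.
Local Open Scope ring_scope.

(** Let [x] be the supremum of the [y] such that the fusible numbers below [y]
    are well-ordered. The set [W] of fusible numbers up to [x] is then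
    well-ordered. A fusible number [z] slightly above [x] is a fusion of
    [a <= b] with [a <= z - 1/2] and [b < z]. Either [b <= x], so [z] is a
    fusion of two elements of [W]; or [b > x], and then [a] exceeds [x - 1] by
    less than [2 (z - x)], which is impossible for [z] close to [x] because [W]
    has a least element above [x - 1]. Fusions of two elements of [W] form a
    well-ordered set, so well-orderedness extends beyond [x]. *)

Section WellOrderedSets.
Local Open Scope classical_set_scope.
Local Open Scope order_scope.
Variables (d : Order.disp_t) (T : orderType d).
Implicit Types (A S : set T) (x y z : T).

Definition least_of A z := A z /\ forall y, A y -> z <= y.

Definition wo_set S :=
  forall A, A `<=` S -> A !=set0 -> exists z, least_of A z.

Lemma wo_set_sub S1 S2 : S1 `<=` S2 -> wo_set S2 -> wo_set S1.
Proof. by move=> S12 wo2 A AS; apply: wo2; apply: subset_trans S12. Qed.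

Lemma wo_setU S1 S2 : wo_set S1 -> wo_set S2 -> wo_set (S1 `|` S2).
Proof.
move=> wo1 wo2 A AS [y0 Ay0].
have [[y1 [Ay1 Sy1]]|n1] := pselect (A `&` S1 !=set0); last first.
  apply: wo2; last by exists y0.
  by move=> y Ay; have [Sy|//] := AS _ Ay; case: n1; exists y.
have [[y2 [Ay2 Sy2]]|n2] := pselect (A `&` S2 !=set0); last first.
  apply: wo1; last by exists y0.
  by move=> y Ay; have [//|Sy] := AS _ Ay; case: n2; exists y.
have [||z1 [[Az1 _] min1]] := wo1 (A `&` S1); [by move=> y []|by exists y1|].
have [||z2 [[Az2 _] min2]] := wo2 (A `&` S2); [by move=> y []|by exists y2|].
exists (Order.min z1 z2); split; first by rewrite minEle; case: ifP.
move=> y Ay; rewrite ge_min; have [Sy|Sy] := AS _ Ay.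
  by rewrite min1.
by rewrite min2 ?orbT.
Qed.

Lemma wo_set1 x : wo_set [set x].
Proof.
move=> A Ax [y Ay]; exists y; split=> // z Az.
by rewrite (Ax _ Ay) (Ax _ Az).
Qed.

(** A least element of [A] can be sought among the elements below any chosen member of [A], so
    well-ordered initial segments suffice. *)
Lemma wo_set_local S :
  (forall y, S y -> wo_set (S `&` [set z | z <= y])) -> wo_set S.
Proof.
move=> wo_le A AS [y Ay].
have [||z [[Az zy] minz]] := wo_le _ (AS _ Ay) (A `&` [set z | z <= y]).
- by move=> z [/AS].
- by exists y; split=> //=.
exists z; split=> // u Au; have [uy|/ltW yu] := leP u y; first exact: minz.
exact: le_trans yu.
Qed.

Lemma wo_set_image2 (f : T -> T -> T) S1 S2 :
    (forall a a' b b', a <= a' -> b <= b' -> f a b <= f a' b') ->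
  wo_set S1 -> wo_set S2 -> wo_set [set f a b | a in S1 & b in S2].
Proof.
move=> f_mono wo1 wo2.
(* A counterexample whose first arguments all satisfy [P]; shrinking [P] drives an infinite descent
   on the first argument. *)
pose bad (P : set T) A := [/\ A !=set0, ~ exists z, least_of A z &
  A `<=` [set f a b | a in S1 `&` P & b in S2]].
(* Take the least [b0] occurring in a counterexample: any smaller value than
   [f a0 b0] then uses some [a < a0]. *)
have descent P A : bad P A -> exists a0, [/\ S1 a0, P a0 &
    exists A', bad [set a | a < a0] A'].
  move=> [[y Ay] nomin AP].
  pose B := S2 `&` [set b | exists2 a, (S1 `&` P) a & A (f a b)].
  have [||b0 [[Sb0 [a0 [Sa0 Pa0] Aab]] minb]] := wo2 B.
  - by move=> b [].
  - have [a Sa [b Sb fab]] := AP _ Ay.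
    by exists b; split=> //; exists a; rewrite ?fab.
  exists a0; split=> //; exists (A `&` [set z | z < f a0 b0]); split.
  - apply: contrapT => n0; apply: nomin; exists (f a0 b0); split=> // u Au.
    by rewrite leNgt; apply/negP => ult; apply: n0; exists u.
  - move=> [z [[Az zlt] minz]]; apply: nomin; exists z; split=> // u Au.
    have [ult|] := ltP u (f a0 b0); first exact: minz.
    exact/le_trans/ltW.
  - move=> z [Az zlt]; have [a [Sa Pa] [b Sb fab]] := AP _ Az.
    exists a; last by exists b.
    split=> //=; rewrite ltNge; apply/negP => a0a.
    move: zlt; rewrite /= -fab ltNge f_mono // minb //.
    by split=> //; exists a; rewrite ?fab.
move=> A AS A0; apply: contrapT => nomin.
have /descent[a [Sa _ bada]] : bad setT A.
  by split=> // y /AS[u Su fu]; exists u.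
(* Take [a1] least such that some counterexample has all its first arguments below [a1]; [descent]
   yields a smaller such element. *)
have [||a1 [[Sa1 [A1 badA1]] mina]] :=
    wo1 (S1 `&` [set a | exists A', bad [set u | u < a] A']).
- by move=> u [].
- by exists a.
have [a2 [Sa2 a21 bada2]] := descent _ _ badA1.
by move: a21 => /=; rewrite ltNge mina.
Qed.

End WellOrderedSets.

Section Fusible.
Local Open Scope classical_set_scope.
Variable R : realType.
Implicit Types (a b x y z : R).

Lemma fusible_ge0 z : fusible z -> 0 <= z.
Proof. by elim=> // a b _ ? _ ? _; rewrite /fuse; lra. Qed.

Lemma fuse_mono a a' b b' : a <= a' -> b <= b' -> fuse a b <= fuse a' b'.
Proof. by rewrite /fuse; lra. Qed.

(** Since [fuse] is symmetric, its arguments can be sorted. Then [a <= b] gives [a <= z - 1/2], and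
    [b < a + 1] gives [b < z]. *)
Lemma fusible_inv z : fusible z -> z = 0 \/
  exists a b, [/\ fusible a, fusible b, a <= b, b < a + 1 & z = fuse a b].
Proof.
case=> [|a b Fa Fb]; first by left.
rewrite ltr_norml => /andP[lo hi]; right.
have [ab|/ltW ba] := leP a b; first by exists a, b; split=> //; lra.
by exists b, a; split=> //; rewrite /fuse; lra.
Qed.

Definition fusible_upto x : set R := [set z | fusible z /\ z <= x].

Definition fusible_below x : set R := [set z | fusible z /\ z < x].

Lemma fusible_gap x : wo_set (fusible_upto x) ->
  exists2 e, 0 < e & forall a, fusible a -> x - 1 < a -> a <= x ->
    x - 1 + e <= a.
Proof.
move=> woW; pose A := fusible_upto x `&` [set a | x - 1 < a].
have [A0|nA] := pselect (A !=set0); last first.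
  by exists 1 => // a Fa lo hi; case: nA; exists a.
have [|z [[_ /= zx] minz]] := woW A _ A0; first by move=> a [].
exists (z - (x - 1)) => [|a Fa lo hi]; first lra.
by rewrite addrC subrK; apply: minz.
Qed.

Lemma wo_fusible_extend x : 0 <= x -> wo_set (fusible_upto x) ->
  exists2 y, x < y & wo_set (fusible_below y).
Proof.
move=> x0 woW; have [e e0 gap] := fusible_gap woW.
set W := fusible_upto x in woW *.
(* The bound [1 / 2] forces [a <= x]; the bound [e / 2] makes [2 * (z - x) < e], contradicting the
   gap when [b > x]. *)
exists (x + Num.min (1 / 2) (e / 2)).
  by rewrite ltrDl lt_min; apply/andP; split; lra.
apply: wo_set_sub (wo_setU woW (wo_set_image2 fuse_mono woW woW)).
move=> z [Fz zlt]; have [zx|xz] := leP z x; first by left.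
have [z1 z2] : z < x + 1 / 2 /\ z < x + e / 2.
  by move: zlt; rewrite -ltrBlDl lt_min => /andP[]; lra.
have [zE|[a [b [Fa Fb ab ba zE]]]] := fusible_inv Fz; first lra.
right; move: zE; rewrite /fuse => zE.
have ax : a <= x by lra.
have [bx|xb] := leP b x; first by exists a => //; exists b.
(* Here [a = 2 * z - 1 - b]: [b < z] gives [a > x - 1], while [b > x] gives [a < x - 1 + e]. *)
by have := gap a Fa; lra.
Qed.

Lemma wo_fusible : wo_set (@fusible R).
Proof.
pose G : set R := [set y | wo_set (fusible_below y)].
(* No fusible number is negative, so this holds vacuously; it makes [G] nonempty and its supremum
   nonnegative. *)
have G0 : G 0.
  by move=> A AF [y /AF[/fusible_ge0 y0]]; rewrite ltNge y0.
have [ubG|nubG] := pselect (has_ubound G); last first.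
  apply: wo_set_local => y Fy.
  have [u Gu yu] : exists2 u, G u & y < u.
    apply: contrapT => nu; apply: nubG; exists y => u Gu.
    by rewrite leNgt; apply/negP => yu; apply: nu; exists u.
  by apply: wo_set_sub Gu => z [Fz /= zy]; split=> //; apply: le_lt_trans yu.
have supG : has_sup G by split=> //; exists 0.
have woW : wo_set (fusible_upto (sup G)).
  (* Each initial segment below [sup G] lies below some [u] in [G]; the point [sup G] itself is then
     added as a singleton. *)
  have Gsup : wo_set (fusible_below (sup G)).
    apply: wo_set_local => y [Fy ysup].
    have [u Gu yu] := sup_gt (ex_intro _ 0 G0) ysup.
    apply: wo_set_sub Gu => z [[Fz _] /= zy]; split=> //.
    exact: le_lt_trans yu.
  apply: wo_set_sub (wo_setU Gsup (wo_set1 (x := sup G))) => z [Fz].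
  by rewrite le_eqVlt => /orP[/eqP ->|]; [right|left].
have [y xy Gy] := wo_fusible_extend (ub_le_sup ubG G0) woW.
by move: xy; rewrite ltNge ub_le_sup.
Qed.

End Fusible.

Theorem theorem2 (R : realType) :
  wo_chain (<=%R : rel R) (mem (fusible_numbers R)).
Proof.
apply: antisymmetric_wo_chain => [x y _ _|A AF [x Ax]]; first exact: le_anti.
have [||z [Az minz]] := @wo_fusible R [set y | y \in A]%classic.
- by move=> y /= Ay; have := AF _ Ay; rewrite inE.
- by exists x.
- by exists z; split=> // y Ay; apply: minz.
Qed.
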